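(* Let $\mathbb{F}$ be a field of characteristic $0$. There is a constant $c>0$ such that, with $S=c\cdot n^2$: if there is a polynomial-time algorithm that, given a $2n\times 2n$ matrix with entries in $M_S(\mathbb{F})$, computes its symmetrized determinant, then there is a polynomial-time algorithm that computes the permanent of $n\times n$ matrices over $\mathbb{F}$.
   Context: For an $N\times N$ matrix $B$ with entries from a (possibly noncommutative) $\mathbb{F}$-algebra, the symmetrized determinant is $\mathrm{sdet}_N(B)=\frac{1}{N!}\sum_{\sigma,\tau\in S_N}\mathrm{sgn}(\sigma)\mathrm{sgn}(\tau)\,B(\tau(1),\sigma(1))B(\tau(2),\sigma(2))\cdots B(\tau(N),\sigma(N))$. $M_S(\mathbb{F})$ is the ring of $S\times S$ matrices over $\mathbb{F}$. *)

(* Defs.v *)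
From mathcomp Require Export all_boot all_order all_fingroup all_algebra.

Set Implicit Arguments.
Unset Strict Implicit.
Unset Printing Implicit Defensive.

Import GRing.Theory.
Local Open Scope ring_scope.

(** * Algorithms over a field

   Over an arbitrary field F, "algorithm" is understood in the sense of
   Blum-Shub-Smale: a finite program, the same for all inputs, which stores
   elements of F in memory cells, performs field operations and equality tests
   on them at unit cost, and may use finitely many constants of F.  It is
   presented here as a structured random access machine: the state consists of
   registers holding natural numbers, used for counting and addressing, and a
   memory of cells holding field elements, reached only through the address
   held in a register.

   There is no multiplication on registers, so that after t steps a register
   holds a number of O(t) bits more than those initially present (as in the
   unit-cost RAM with addition and subtraction), and there is no conversion
   between field elements and numbers.  *)

Section Machine.

Variable F : fieldType.

Record state := State { reg : nat -> nat; mem : nat -> F }.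

Definition set_reg (s : state) (i v : nat) : state :=
  State [eta reg s with i |-> v] (mem s).

(* [i] is a register number: the cell written is the one [i] points to. *)
Definition set_cell (s : state) (i : nat) (a : F) : state :=
  State (reg s) [eta mem s with reg s i |-> a].

Definition cell (s : state) (i : nat) : F := mem s (reg s i).

Inductive instr :=
| RConst of nat & nat
| RCopy of nat & nat
| RAdd of nat & nat & nat
| RSub of nat & nat & nat
| FConst of nat & F
| FCopy of nat & nat
| FAdd of nat & nat & nat
| FSub of nat & nat & nat
| FMul of nat & nat & nat
| FDiv of nat & nat & nat.

(* Destination first.  [RSub] is truncated subtraction, and [FDiv] by 0
   yields 0. *)
Definition step (c : instr) (s : state) : state :=
  match c with
  | RConst i v => set_reg s i v
  | RCopy i j => set_reg s i (reg s j)
  | RAdd i j k => set_reg s i (reg s j + reg s k)%N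
  | RSub i j k => set_reg s i (reg s j - reg s k)%N
  | FConst i a => set_cell s i a
  | FCopy i j => set_cell s i (cell s j)
  | FAdd i j k => set_cell s i (cell s j + cell s k)
  | FSub i j k => set_cell s i (cell s j - cell s k)
  | FMul i j k => set_cell s i (cell s j * cell s k)
  | FDiv i j k => set_cell s i (cell s j / cell s k)
  end.

Inductive test :=
| TLt of nat & nat
| TEq of nat & nat.

(* [TLt] compares registers, [TEq] compares cells; F carries no order. *)
Definition holds (b : test) (s : state) : bool :=
  match b with
  | TLt i j => (reg s i < reg s j)%N
  | TEq i j => cell s i == cell s j
  end.

Inductive prog :=
| Instr of instr
| Seq of prog & prog
| If of test & prog & prog
| While of test & prog.

(* [exec P s t s']: started in [s], the program [P] halts in [s'] after
   exactly [t] instructions and tests. *)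
Inductive exec : prog -> state -> nat -> state -> Prop :=
| ExecInstr c s : exec (Instr c) s 1 (step c s)
| ExecSeq P Q s1 t1 s2 t2 s3 :
    exec P s1 t1 s2 -> exec Q s2 t2 s3 -> exec (Seq P Q) s1 (t1 + t2) s3
| ExecIfT b P Q s t s' :
    holds b s -> exec P s t s' -> exec (If b P Q) s t.+1 s'
| ExecIfF b P Q s t s' :
    ~~ holds b s -> exec Q s t s' -> exec (If b P Q) s t.+1 s'
| ExecWhileT b P s1 t1 s2 t2 s3 :
    holds b s1 -> exec P s1 t1 s2 -> exec (While b P) s2 t2 s3 ->
    exec (While b P) s1 (t1 + t2).+1 s3
| ExecWhileF b P s : ~~ holds b s -> exec (While b P) s 1 s.

Lemma exec_det P s t1 s1 t2 s2 :
  exec P s t1 s1 -> exec P s t2 s2 -> t1 = t2 /\ s1 = s2.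
Proof.
move=> e1; elim: e1 t2 s2 => {P s t1 s1} >.
all: move=> *; match goal with e : exec _ _ _ _ |- _ => inversion e; subst end.
all: repeat match goal with
  | h : is_true (holds ?b ?s), h' : is_true (~~ holds ?b ?s) |- _ =>
      by rewrite h in h'
  | IH : forall t s, exec ?P ?s0 t s -> _, e : exec ?P ?s0 _ _ |- _ =>
      case: (IH _ _ e) => ? ?; subst; clear e
  end; by [].
Qed.

(* The size parameter is in register 0, the input is in the first cells, and
   all other registers and cells are 0. *)
Definition init (n : nat) (x : seq F) : state :=
  State [eta (fun=> 0%N) with 0%N |-> n] (nth 0 x).

(* A polynomial-time algorithm for the family [f n : X n -> Y n], where
   inputs and outputs are written as sequences of field elements; time is
   measured in terms of the length of the input, and the output is read off
   the first cells of the final memory.  *)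
Definition poly_time (X Y : nat -> Type)
    (enc_in : forall n, X n -> seq F) (enc_out : forall n, Y n -> seq F)
    (f : forall n, X n -> Y n) : Prop :=
  exists (P : prog) (k : nat), forall (n : nat) (x : X n),
    exists (t : nat) (s : state),
      [/\ exec P (init n (enc_in n x)) t s,
          (t <= k * (size (enc_in n x)).+1 ^ k)%N
        & mkseq (mem s) (size (enc_out n (f n x))) = enc_out n (f n x)].

Definition scalar_code (a : F) : seq F := [:: a].

(* Row-major order. *)
Definition mx_code (m n : nat) (A : 'M[F]_(m, n)) : seq F :=
  flatten [seq [seq A i j | j : 'I_n] | i : 'I_m].

Definition mxmx_code (S N : nat) (B : 'M['M[F]_S]_N) : seq F :=
  flatten [seq flatten [seq mx_code (B i j) | j : 'I_N] | i : 'I_N].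

End Machine.

(** * Symmetrized determinant and permanent *)

(* For the algebra of S x S matrices; it is not stated over an [algType F]
   because ['M[F]_S] is one only when S is syntactically a successor.  The
   product is the ordered one, over rows and columns numbered from 0. *)
Definition sdet (F : fieldType) (S N : nat) (B : 'M['M[F]_S]_N) : 'M[F]_S :=
  (N`!%:R : F)^-1 *:
    \sum_(s : 'S_N) \sum_(t : 'S_N)
      (-1) ^+ s * (-1) ^+ t * \prod_(i < N) B (t i) (s i).

Definition permanent (F : fieldType) (n : nat) (A : 'M[F]_n) : F :=
  \sum_(s : 'S_n) \prod_(i < n) A i (s i).

(* Main.v *)
(** In the algebra of matrices with units E_(p,q), put
    B(i, j) = (n + 1 + i) A(i, j) E_(0, in+j+1),  B(n + i, n + j) = E_(in+j+1, 0)
    for i, j < n, and 0 elsewhere.  The (0, 0) entry of an ordered product of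
    entries of B vanishes unless the factors pair up as B(i, j) B(n + i, n + j),
    so that only pairs of permutations of 2n obtained by interleaving
    permutations of n survive; their signs agree, because multiplying by a
    transposition of n changes the interleaved permutation by two
    transpositions.  The surviving terms add up to
    (2n)! / n! * n! * perm A, the first factor being the product of the weights
    n + 1 + i, hence the (0, 0) entry of sdet B is perm A.

    The reduction builds B in place from A.  The cells are visited in decreasing
    order of in + j, and both nonzero entries due to A(i, j) lie beyond cell
    in + j, so no entry of A is overwritten before it is read.  The weight
    n + 1 + i, which no instruction can convert from a register, is obtained by
    repeated addition. *)
Require Import Defs.
From mathcomp Require Import zify.
From Stdlib Require Import FunctionalExtensionality.

Set Implicit Arguments.
Unset Strict Implicit.
Unset Printing Implicit Defensive.

Import GRing.Theory.
Local Open Scope ring_scope.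

(** * Permutations of 2n that interleave two copies of a permutation of n *)

Section InterleavedPerm.

Variable n : nat.
Implicit Types (s t : 'S_n) (u : 'S_(2 * n)) (i j l : 'I_n).

Fact lo_subproof i : (i < 2 * n)%N. Proof. by have := ltn_ord i; lia. Qed.
Fact hi_subproof i : (n + i < 2 * n)%N. Proof. by have := ltn_ord i; lia. Qed.
Fact even_subproof i : (2 * i < 2 * n)%N. Proof. by have := ltn_ord i; lia. Qed.
Fact odd_subproof i : ((2 * i).+1 < 2 * n)%N.
Proof. by have := ltn_ord i; lia. Qed.
Fact half_subproof (k : 'I_(2 * n)) : (k./2 < n)%N.
Proof. by have := ltn_ord k; lia. Qed.

Definition lo_ord i : 'I_(2 * n) := Ordinal (lo_subproof i).
Definition hi_ord i : 'I_(2 * n) := Ordinal (hi_subproof i).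
Definition even_ord i : 'I_(2 * n) := Ordinal (even_subproof i).
Definition odd_ord i : 'I_(2 * n) := Ordinal (odd_subproof i).
Definition half_ord (k : 'I_(2 * n)) : 'I_n := Ordinal (half_subproof k).

Lemma lo_ord_inj : injective lo_ord.
Proof. by move=> i j /(congr1 val) /= /val_inj. Qed.

Lemma hi_ord_inj : injective hi_ord.
Proof. by move=> i j /(congr1 val) /= /addnI /val_inj. Qed.

Lemma lo_neq_hi i j : lo_ord i != hi_ord j.
Proof. by rewrite -val_eqE /=; have := ltn_ord i; lia. Qed.

(** Partners i and n + i sit at positions 2l and 2l+1, so that the units they select are adjacent
    factors of the ordered product. *)
Definition interleave_fun s (k : 'I_(2 * n)) :=
  if odd k then hi_ord (s (half_ord k)) else lo_ord (s (half_ord k)).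

Lemma interleave_inj s : injective (interleave_fun s).
Proof.
move=> k k'; rewrite /interleave_fun; case: ifP => ok; case: ifP => ok'.
- move=> /hi_ord_inj /perm_inj /(congr1 val) /= h; apply: val_inj => /=; lia.
- by move=> h; have := lo_neq_hi (s (half_ord k')) (s (half_ord k)); rewrite h eqxx.
- by move=> h; have := lo_neq_hi (s (half_ord k)) (s (half_ord k')); rewrite h eqxx.
- move=> /lo_ord_inj /perm_inj /(congr1 val) /= h; apply: val_inj => /=; lia.
Qed.

Definition interleave s : 'S_(2 * n) := perm (@interleave_inj s).

Lemma half_even l : half_ord (even_ord l) = l.
Proof. by apply: val_inj => /=; lia. Qed.

Lemma half_odd l : half_ord (odd_ord l) = l.
Proof. by apply: val_inj => /=; lia. Qed.

Lemma interleave_even s l : interleave s (even_ord l) = lo_ord (s l).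
Proof.
rewrite permE /interleave_fun half_even ifF //=; lia.
Qed.

Lemma interleave_odd s l : interleave s (odd_ord l) = hi_ord (s l).
Proof.
rewrite permE /interleave_fun half_odd ifT //=; lia.
Qed.

Lemma even_odd_ind (P : 'I_(2 * n) -> Prop) :
  (forall l, P (even_ord l)) -> (forall l, P (odd_ord l)) -> forall k, P k.
Proof.
move=> Pe Po k; case ok: (odd k).
- by have -> : k = odd_ord (half_ord k) by apply: val_inj => /=; lia.
- by have -> : k = even_ord (half_ord k) by apply: val_inj => /=; lia.
Qed.

Lemma interleave_injective : injective interleave.
Proof.
move=> s t est; apply/permP => l; apply: lo_ord_inj.
by rewrite -!interleave_even est.
Qed.

(** The lower and upper halves are disjoint, and each transposition on the right acts on one half
    only. *)
Lemma interleave_mul_tperm s i j :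
  interleave (s * tperm i j) =
    (interleave s * tperm (lo_ord i) (lo_ord j)
                  * tperm (hi_ord i) (hi_ord j))%g.
Proof.
apply/permP; apply: even_odd_ind => l; rewrite !permM.
- rewrite !interleave_even permM -(inj_tperm _ _ _ lo_ord_inj).
  by rewrite (@tpermD _ (hi_ord i)) // eq_sym lo_neq_hi.
- rewrite !interleave_odd permM (@tpermD _ (lo_ord _)) ?lo_neq_hi //.
  by rewrite (inj_tperm _ _ _ hi_ord_inj).
Qed.

(** Each factor of s, written as a product of transpositions, contributes two transpositions. A
    common parity suffices, as signs enter [sdet] in pairs. *)
Lemma odd_interleave s : odd_perm (interleave s) = odd_perm (interleave 1).
Proof.
have [ts -> _] := prod_tpermP s.
suff mul_ts (u : 'S_n) : odd_perm (interleave (u * \prod_(t <- ts) tperm t.1 t.2)) =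
                odd_perm (interleave u) by rewrite -[X in interleave X]mul1g mul_ts.
elim: ts u => [|t ts IH] u.
  by rewrite big_nil mulg1.
rewrite big_cons mulgA IH interleave_mul_tperm !odd_permM !odd_tperm.
by rewrite (inj_eq lo_ord_inj) (inj_eq hi_ord_inj) -addbA addbb addbF.
Qed.

Definition interleaved u :=
  [forall l : 'I_n, (u (even_ord l) < n)%N &&
                    (u (odd_ord l) == n + u (even_ord l) :> nat)%N].

Lemma interleavedE u : interleaved u = (u \in interleave @: [set: 'S_n]).
Proof.
apply/forallP/imsetP => [gu | [s _ ->] l]; last first.
  by rewrite interleave_even interleave_odd /= ltn_ord eqxx.
(* The values at even positions are distinct and below n, so they form the permutation to be
   interleaved. *)
pose f l : 'I_n := Ordinal (proj1 (andP (gu l))).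
have f_inj : injective f.
  move=> i j /(congr1 val) /= /val_inj /perm_inj /(congr1 val) /= h.
  by apply: val_inj => /=; lia.
exists (perm f_inj) => //; apply/permP; apply: even_odd_ind => l.
- by rewrite interleave_even; apply: val_inj; rewrite /= permE.
- rewrite interleave_odd; apply: val_inj; rewrite /= permE /=.
  by have /andP[_ /eqP] := gu l.
Qed.

Lemma sum_interleaved (V : nmodType) (f : 'S_(2 * n) -> V) :
  (forall u, ~~ interleaved u -> f u = 0) ->
  \sum_u f u = \sum_s f (interleave s).
Proof.
move=> f0; rewrite (bigID interleaved) /= addrC big1 ?add0r //.
rewrite (eq_bigl _ _ interleavedE) big_imset /=.
  by apply: eq_bigl => s; rewrite inE.
by move=> s t _ _ /interleave_injective.
Qed.

End InterleavedPerm.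

(** * The matrix B and the (0, 0) entry of its symmetrized determinant *)

Section Gadget.

Variables (F : fieldType) (n : nat) (g : nat -> F).

(* Only the contributions of the A(i, j) with [u <= i * n + j] are kept; [u = 0]
   gives all of B. *)
Definition entry (u r c p q : nat) : F :=
  if [&& r < n, c < n, p == 0, q == (r * n + c).+1 & u < q]%N
  then (n + r).+1%:R * g (r * n + c)
  else if [&& n <= r < 2 * n, n <= c < 2 * n, q == 0,
              p == ((r - n) * n + (c - n)).+1 & u < p]%N
  then 1 else 0.

Definition gadget (S : nat) : 'M['M[F]_S]_(2 * n) :=
  \matrix_(r, c) \matrix_(p < S, q < S) entry 0 r c p q.

Definition pair_weight (r c r' c' : nat) : F :=
  if [&& r < n, c < n, r' == (n + r)%N & c' == (n + c)%N]%N
  then (n + r).+1%:R * g (r * n + c) else 0.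

Lemma index_lt_sqr r c : (r < n -> c < n -> r * n + c < n ^ 2)%N.
Proof. by move=> rn cn; nia. Qed.

Lemma index_inj i j i' j' : (j < n -> j' < n ->
  i * n + j = i' * n + j' -> i = i' /\ j = j')%N.
Proof.
move=> jn jn' /(congr1 (fun m => (m %/ n, m %% n)%N)).
by rewrite !modnMDl !divnMDl ?(leq_trans _ jn) // !modn_small // !divn_small // !addn0 => -[].
Qed.

Variables (S : nat) (o : 'I_S).
Hypotheses (o0 : o = 0%N :> nat) (S_gt : (n ^ 2 < S)%N).

(** A factor with r, c < n sends e_0 to a multiple of e_(rn+c+1), and only the partner unit sends
    that back to e_0. As rn+c+1 is never 0, any other second factor kills it; any other first factor
    kills e_0. *)
Lemma gadget_pair (r c r' c' : 'I_(2 * n)) :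
  delta_mx 0 o *m (gadget S r c *m gadget S r' c')
    = pair_weight r c r' c' *: delta_mx 0 o :> 'rV_S.
Proof.
rewrite mulmxA -rowE; apply/rowP => q; rewrite !mxE eqxx /=.
under eq_bigr => p _ do rewrite !mxE o0 /entry eqxx /= [in X in X * _]andbF.
case: (boolP ((r < n) && (c < n))%N) => [/andP[rn cn] | nrc]; last first.
  rewrite big1 => [|p _]; first by rewrite /pair_weight andbA (negbTE nrc) mul0r.
  rewrite andbA (negbTE nrc) /=; case: ifP => [|_]; last by rewrite mul0r.
  by rewrite !andbF.
have kS : ((r * n + c).+1 < S)%N by have := index_lt_sqr rn cn; lia.
rewrite (bigD1 (Ordinal kS)) //= big1 => [|p /eqP pk]; last first.
  rewrite rn cn /= ifF.
    by rewrite ifF ?mul0r // !andbF.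
  by apply/negP => /andP[/eqP pE _]; apply: pk; apply: val_inj.
rewrite addr0 rn cn eqxx /= andbF /pair_weight rn cn /=.
case: (boolP ((r' == n + r :> nat) && (c' == n + c :> nat))%N) => [|nrc'].
  move=> /andP[/eqP r'E /eqP c'E].
  rewrite r'E c'E !addKn !eqxx /= !andbT.
  case: eqP => [qo|/eqP qo].
    have -> : q = o by apply: val_inj; rewrite /= qo.
    rewrite eqxx andbF ifT //; lia.
  suff -> : (q == o) = false by rewrite !andbF mulr0.
  by apply: contraNF qo => /eqP ->; rewrite o0.
rewrite andbF ifF ?mul0r ?mulr0 //; apply/negP => /and4P[/andP[r'n _] /andP[c'n c'2] _].
rewrite andbT eqSS => /eqP idx; have [|r'E c'E] := index_inj cn _ idx; first lia.
by move/negP: nrc'; apply; apply/andP; split; apply/eqP; lia.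
Qed.

(** Taken two at a time, the factors have e_0 as a common eigenvector. Indexing by natural numbers
    lets the number of pairs vary in the induction. *)
Lemma gadget_path (t s : nat -> 'I_(2 * n)) m :
  delta_mx 0 o *m \prod_(i < 2 * m) gadget S (t i) (s i)
    = (\prod_(l < m) pair_weight (t (2 * l)%N) (s (2 * l)%N)
                                 (t (2 * l).+1) (s (2 * l).+1)) *: delta_mx 0 o
  :> 'rV_S.
Proof.
elim: m => [|m IH]; first by rewrite !big_ord0 scale1r mulmx1.
rewrite mulnS !big_ord_recr /= -[X in X * _ * _]/(\prod_(i < 2 * m) _).
by rewrite -mulrA -[_ * _]/(_ *m _) mulmxA IH -scalemxAl gadget_pair scalerA.
Qed.

Lemma prod_gadget (n_gt0 : (0 < n)%N) (t s : 'S_(2 * n)) :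
  (\prod_(i < 2 * n) gadget S (t i) (s i)) o o =
  \prod_(l < n) pair_weight (t (even_ord l)) (s (even_ord l))
                            (t (odd_ord l)) (s (odd_ord l)).
Proof.
(* [i0] is a default value: [f] extends a permutation to all natural numbers, as [gadget_path]
   requires. *)
pose i0 : 'I_(2 * n) := Ordinal (leq_trans n_gt0 (leq_pmull n (isT : (0 < 2)%N))).
pose f (u : 'S_(2 * n)) k := u (insubd i0 k).
have fE u (k : 'I_(2 * n)) : f u k = u k by rewrite /f valKd.
have -> : \prod_(i < 2 * n) gadget S (t i) (s i) = \prod_(i < 2 * n) gadget S (f t i) (f s i).
  by apply: eq_bigr => i _; rewrite !fE.
have := congr1 (fun v : 'rV_S => v 0 o) (gadget_path (f t) (f s) n).
rewrite -rowE !mxE !eqxx mulr1 => ->; apply: eq_bigr => l _.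
by rewrite -!(fE _ (even_ord l)) -!(fE _ (odd_ord l)).
Qed.

Lemma pair_weight_interleave (s t : 'S_n) (l : 'I_n) :
  pair_weight (interleave t (even_ord l)) (interleave s (even_ord l))
              (interleave t (odd_ord l)) (interleave s (odd_ord l))
  = (n + t l).+1%:R * g (t l * n + s l).
Proof.
by rewrite !interleave_even !interleave_odd /pair_weight /= !ltn_ord !eqxx.
Qed.

(** The weights n+1, ..., 2n and the n! choices of t will together cancel the normalization of
    [sdet]. *)
Lemma prod_shift_fact :
  (\prod_(l < n) (n + l).+1 * n`! = (2 * n)`!)%N.
Proof.
suff : forall m, (\prod_(l < m) (n + l).+1 * n`! = (n + m)`!)%N by move=> ->; rewrite mul2n addnn.
elim=> [|m IH]; first by rewrite big_ord0 mul1n addn0.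
by rewrite big_ord_recr /= addnS factS -IH mulnAC mulnC.
Qed.

Lemma sdet_gadget (n_gt0 : (0 < n)%N) (charF0 : [pchar F] =i pred0) :
  sdet (gadget S) o o = permanent (\matrix_(i < n, j < n) g (i * n + j)).
Proof.
pose A : 'M_n := \matrix_(i < n, j < n) g (i * n + j).
pose w (t s : 'S_(2 * n)) :=
  \prod_(l < n) pair_weight (t (even_ord l)) (s (even_ord l))
                            (t (odd_ord l)) (s (odd_ord l)).
have w0 t s : ~~ (interleaved t && interleaved s) -> w t s = 0.
  move=> nts; apply/eqP/prodf_eq0.
  have [l nl] : exists l : 'I_n, ~~ [&& t (even_ord l) < n, s (even_ord l) < n,
      t (odd_ord l) == n + t (even_ord l) :> nat &
      s (odd_ord l) == n + s (even_ord l) :> nat]%N.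
    apply/existsP; apply: contraNT nts; rewrite negb_exists => /forallP al.
    by apply/andP; split; apply/forallP => l; have /negPn/and4P[h1 h2 h3 h4] := al l; apply/andP.
  by exists l => //; rewrite /pair_weight (negbTE nl).
have fact_neq0 m : m`!%:R != 0 :> F by rewrite (proj1 (pcharf0P F) charF0) -lt0n fact_gt0.
rewrite /sdet !mxE summxE.
rewrite (eq_bigr (fun s : 'S_(2 * n) => \sum_(t : 'S_(2 * n))
    (-1) ^+ s * (-1) ^+ t * w t s)); last first.
  move=> s _; rewrite summxE; apply: eq_bigr => t _.
  rewrite -!signr_addb !mulr_sign /w -prod_gadget //.
  by case: ifP; rewrite ?mxE.
transitivity ((2 * n)`!%:R^-1 * \sum_(s : 'S_n) \sum_(t : 'S_n)
    w (interleave t) (interleave s)).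
  congr (_ * _); rewrite sum_interleaved => [|s ns]; last first.
    by apply: big1 => t _; rewrite w0 ?mulr0 // (negbTE ns) andbF.
  apply: eq_bigr => s _; rewrite sum_interleaved => [|t nt]; last first.
    by rewrite w0 ?mulr0 // (negbTE nt).
  apply: eq_bigr => t _.
  by rewrite -signr_addb !odd_interleave addbb mul1r.
(* Reindexing the factors by t makes the weights a constant and lets the entries depend on t^-1 s
   only. *)
have wE t s : w (interleave t) (interleave s) =
    (\prod_(l < n) (n + l).+1)%:R * \prod_l A l ((t^-1 * s)%g l).
  rewrite /w (eq_bigr _ (fun l _ => pair_weight_interleave s t l)).
  rewrite big_split natr_prod [in RHS](reindex_inj (@perm_inj _ t)) /=.
  rewrite [in RHS]mulrC [in RHS](reindex_inj (@perm_inj _ t)) mulrC /=; congr (_ * _).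
  by apply: eq_bigr => l _; rewrite mxE permM permK.
under eq_bigr => s _ do under eq_bigr => t _ do rewrite wE.
rewrite exchange_big /=.
have permE (t : 'S_n) : \sum_(s : 'S_n) \prod_(l < n) A l ((t^-1 * s : 'S_n)%g l) = permanent A.
  rewrite (reindex_inj (mulgI t)); apply: eq_bigr => s _.
  by apply: eq_bigr => l _; rewrite mulKg.
under eq_bigr => t _ do rewrite -big_distrr /= permE.
rewrite sumr_const card_Sn -[(_ * permanent _) *+ _]mulr_natr mulrAC -natrM prod_shift_fact.
by rewrite mulKf.
Qed.

End Gadget.

(** * Row-major codes and the addresses of entries *)

Section Codes.

Variable F : fieldType.

Lemma size_flatten_const (T : Type) k (ss : seq (seq T)) :
  all (fun s => size s == k) ss -> size (flatten ss) = (size ss * k)%N.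
Proof. by elim: ss => //= s ss IH /andP[/eqP sk /IH]; rewrite size_cat sk => ->. Qed.

Lemma nth_flatten_const (T : Type) (x0 : T) k (ss : seq (seq T)) i q :
  all (fun s => size s == k) ss -> (q < k)%N ->
  nth x0 (flatten ss) (i * k + q) = nth x0 (nth [::] ss i) q.
Proof.
move=> + qk; elim: ss i => [|s ss IH] [|i] //= ; rewrite ?nth_nil // => /andP[/eqP sk ssk].
  by rewrite nth_cat mul0n sk qk.
by rewrite nth_cat sk mulSn ltnNge -!addnA leq_addr /= addKn IH.
Qed.

Lemma nth_codom_ord (T : Type) (x0 : T) m (f : 'I_m -> T) (i : 'I_m) :
  nth x0 [seq f k | k : 'I_m] i = f i.
Proof. by rewrite (nth_map i) ?nth_ord_enum // size_enum_ord. Qed.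

Lemma all_size_codom (T : Type) k m (f : 'I_m -> seq T) :
  (forall i, size (f i) = k) -> all (fun s => size s == k) [seq f i | i : 'I_m].
Proof. by move=> fk; rewrite all_map; apply/allP => i _ /=; rewrite fk. Qed.

Lemma size_mx_code m k (A : 'M[F]_(m, k)) : size (mx_code A) = (m * k)%N.
Proof.
rewrite (size_flatten_const (k := k)) ?size_image ?card_ord //.
by apply: all_size_codom => i; rewrite size_image card_ord.
Qed.

Lemma nth_mx_code m k (A : 'M[F]_(m, k)) (i : 'I_m) (j : 'I_k) :
  nth 0 (mx_code A) (i * k + j) = A i j.
Proof.
rewrite nth_flatten_const ?ltn_ord //; last first.
  by apply: all_size_codom => ?; rewrite size_image card_ord.
by rewrite !nth_codom_ord.
Qed.

Lemma size_mxmx_code S N (B : 'M['M[F]_S]_N) :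
  size (mxmx_code B) = (N * (N * (S * S)))%N.
Proof.
rewrite (size_flatten_const (k := (N * (S * S))%N)) ?size_image ?card_ord //.
apply: all_size_codom => i.
rewrite (size_flatten_const (k := (S * S)%N)) ?size_image ?card_ord //.
by apply: all_size_codom => j; rewrite size_mx_code.
Qed.

Definition position (N S r c p q : nat) : nat :=
  (r * (N * (S * S)) + (c * (S * S) + (p * S + q)))%N.

Lemma position_ltn N S c p q : (c < N -> p < S -> q < S ->
  (c * (S * S) + (p * S + q) < N * (S * S)) * (p * S + q < S * S))%N.
Proof.
move=> cN pS qS; have h : (p * S + q < S * S)%N by nia.
by split => //; nia.
Qed.

Lemma nth_mxmx_code S N (B : 'M['M[F]_S]_N) (r c : 'I_N) (p q : 'I_S) :
  nth 0 (mxmx_code B) (position N S r c p q) = B r c p q.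
Proof.
have [ltNS ltS] := position_ltn (ltn_ord c) (ltn_ord p) (ltn_ord q).
have sizeS i : all (fun s => size s == (S * S)%N) [seq mx_code (B i j) | j : 'I_N].
  by apply: all_size_codom => j; rewrite size_mx_code.
rewrite nth_flatten_const ?ltn_ord //; last first.
  apply: all_size_codom => i; rewrite (size_flatten_const (sizeS i)).
  by rewrite size_image card_ord.
by rewrite nth_codom_ord nth_flatten_const // nth_codom_ord nth_mx_code.
Qed.

(** Mixed-radix digits of an address; the leading one is unbounded, so addresses beyond the matrix
    decode as well. *)
Definition row_of N S a := (a %/ (N * (S * S)))%N.
Definition col_of N S a := (a %% (N * (S * S)) %/ (S * S))%N.
Definition subrow_of N S a := (a %% (N * (S * S)) %% (S * S) %/ S)%N.
Definition subcol_of N S a := (a %% (N * (S * S)) %% (S * S) %% S)%N.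

Lemma position_of N S a : 
  position N S (row_of N S a) (col_of N S a) (subrow_of N S a) (subcol_of N S a) = a.
Proof. by rewrite /position -!divn_eq. Qed.

Lemma of_position N S r c p q : (c < N -> p < S -> q < S ->
  [/\ row_of N S (position N S r c p q) = r, col_of N S (position N S r c p q) = c,
      subrow_of N S (position N S r c p q) = p & subcol_of N S (position N S r c p q) = q])%N.
Proof.
move=> cN pS qS; have [ltNS ltS] := position_ltn cN pS qS.
rewrite /row_of /col_of /subrow_of /subcol_of /position.
have [S_gt0 NS_gt0 SS_gt0] : [/\ 0 < S, 0 < N * (S * S) & 0 < S * S]%N by split; lia.
rewrite !modnMDl !divnMDl // !(modn_small ltNS) !(divn_small ltNS).
rewrite !modnMDl !divnMDl // !(modn_small ltS) !(divn_small ltS).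
by rewrite !modnMDl !divnMDl // !(modn_small qS) !(divn_small qS) !addn0.
Qed.

End Codes.

(** * Memory contents during the in-place construction *)

Section Memory.

Variables (F : fieldType) (n : nat) (g : nat -> F).
Hypothesis n_gt0 : (0 < n)%N.
Hypothesis g_out : forall a, (n ^ 2 <= a)%N -> g a = 0.
Let N := (2 * n)%N.
Let S := (4 * n ^ 2)%N.

(* Memory once all (i, j) with [u <= i * n + j] have been processed. *)
Definition memory (u a : nat) : F :=
  if (a < u)%N then g a
  else entry n g u (row_of N S a) (col_of N S a) (subrow_of N S a) (subcol_of N S a).

Lemma block_size_gt0 : (0 < S)%N. Proof. by rewrite /S; nia. Qed.

Lemma memory_full : memory (n ^ 2) = g.
Proof.
apply: functional_extensionality => a; rewrite /memory; case: ltnP => // na.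
(* Beyond the input every unit is filtered out: its number rn+c+1 would have to exceed n^2. *)
rewrite g_out // /entry ifF; last first.
  apply/negP => /and5P[rn cn _ /eqP -> ]; rewrite ltnS leqNgt.
  by rewrite index_lt_sqr.
rewrite ifF //; apply/negP => /and5P[rn cn _ /eqP -> ]; rewrite ltnS leqNgt.
by rewrite index_lt_sqr //; lia.
Qed.

Lemma memory_empty : memory 0 = nth 0 (mxmx_code (gadget n g S)).
Proof.
apply: functional_extensionality => a; rewrite /memory ltn0.
have pS : (subrow_of N S a < S)%N.
  by rewrite /subrow_of ltn_divLR ?block_size_gt0 // ltn_mod muln_gt0 block_size_gt0.
have qS : (subcol_of N S a < S)%N by rewrite ltn_mod block_size_gt0.
have cN : (col_of N S a < N)%N.
  have SS_gt0 : (0 < S * S)%N by rewrite muln_gt0 block_size_gt0.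
  by rewrite /col_of ltn_divLR // ltn_pmod // muln_gt0 SS_gt0 andbT; lia.
case: (ltnP (row_of N S a) N) => [rN | Nr].
  rewrite -[in RHS](position_of N S a).
  rewrite (nth_mxmx_code (gadget n g S) (Ordinal rN) (Ordinal cN) (Ordinal pS) (Ordinal qS)).
  by rewrite !mxE.
(* Past the end of the code [nth] yields 0, and [entry] vanishes because both its branches bound the
   row by 2n. *)
rewrite nth_default; last first.
  rewrite size_mxmx_code -(position_of N S a) /position -/N.
  by apply: leq_trans (leq_addr _ _); rewrite leq_mul2r Nr orbT.
rewrite /entry ifF; last by apply/negP => /andP[]; rewrite /N in Nr *; lia.
by rewrite ifF //; apply/negP => /andP[]; rewrite /N in Nr *; lia.
Qed.

Definition row_cell (i j : nat) : nat := position N S i j 0 (i * n + j).+1.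
Definition col_cell (i j : nat) : nat := position N S (n + i) (n + j) (i * n + j).+1 0.

(** The shift in the unit's index in+j+1 makes this strict even at i = j = 0. *)
Lemma row_cell_gt i j : (i * n + j < row_cell i j)%N.
Proof. rewrite /row_cell /position; lia. Qed.

Lemma col_cell_gt i j : (i * n + j < col_cell i j)%N.
Proof. by have := block_size_gt0; rewrite /col_cell /position; nia. Qed.

Lemma memory_read u a : (a < u)%N -> memory u a = g a.
Proof. by rewrite /memory => ->. Qed.

(** Lowering the threshold to in+j removes the cell in+j from the part still holding A and admits
    the two units numbered in+j+1. *)
Lemma memory_step i j : (i < n)%N -> (j < n)%N ->
  memory (i * n + j) =
    [eta [eta [eta memory (i * n + j).+1
      with row_cell i j |-> (n + i).+1%:R * g (i * n + j)]
      with (i * n + j)%N |-> 0]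
      with col_cell i j |-> 1].
Proof.
move=> i_lt j_lt; apply: functional_extensionality => a /=.
have yS : ((i * n + j).+1 < S)%N by have := index_lt_sqr i_lt j_lt; rewrite /S; lia.
have := row_cell_gt i j; have := col_cell_gt i j.
set y := (i * n + j)%N in yS *.
case: eqP => [-> zy _ | az zy].
  rewrite /memory ltnNge ltnW //=.
  have jN : (n + j < N)%N by rewrite /N; lia.
  have [-> -> -> ->] := of_position (n + i) jN yS block_size_gt0.
  rewrite /entry ifF; last by apply/negP => /andP[]; lia.
  by rewrite !addKn !eqxx ifT //; lia.
case: eqP => [-> xy | ay].
  rewrite /memory ltnn /entry !ifF //.
    apply/negP => /and5P[_ _ _ _]; rewrite ltnNge => /negP; apply.
    by rewrite -[X in (_ <= X)%N](position_of N S) /position; nia.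
  apply/negP => /and5P[_ _ _ _]; rewrite ltnNge => /negP; apply.
  by rewrite -[X in (_ <= X)%N](position_of N S) /position; nia.
case: eqP => [-> xy | ax xy].
  rewrite /memory ltnNge ltnW //=.
  have jN : (j < N)%N by rewrite /N; lia.
  have [-> -> -> ->] := of_position i jN block_size_gt0 yS.
  by rewrite /entry i_lt j_lt !eqxx ltnSn.
rewrite /memory ltnS [in RHS]leq_eqVlt (introF eqP ay) /=; case: ltnP => // ya.
(* Elsewhere both thresholds admit the same units: a unit numbered in+j+1 has (i, j) recovered from
   its digits, which makes a one of the two new cells. *)
rewrite /entry; congr (if _ then _ else _); last congr (if _ then _ else _).
- apply/and5P/and5P => -[rn cn p0 qk uq]; split=> //; last exact: ltnW.
  rewrite ltn_neqAle uq andbT; apply/eqP => uE; apply: ax.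
  have [|ri cj] := index_inj (i := i) (i' := row_of N S a) j_lt cn; first by move: qk; lia.
  by rewrite -[LHS](position_of N S) (eqP p0) -uE -ri -cj.
- apply/and5P/and5P => -[rn cn q0 pk up]; split=> //; last exact: ltnW.
  rewrite ltn_neqAle up andbT; apply/eqP => uE; apply: az.
  have [||ri cj] := index_inj (i := i) (i' := row_of N S a - n) (j' := col_of N S a - n) j_lt.
    by move: cn; lia.
    by move: pk; lia.
  rewrite -[LHS](position_of N S) (eqP q0) -uE; congr position; move: rn cn; lia.
Qed.

End Memory.

(** * Time-bounded runs, counting loops and register multiplication *)

Section Runs.

Variable F : fieldType.
Implicit Types (P Q : prog F) (s : state F).

Definition runs P s (T : nat) s' : Prop := exists2 t, exec P s t s' & (t <= T)%N.

Lemma runs_weaken P s T T' s' : (T <= T')%N -> runs P s T s' -> runs P s T' s'.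
Proof. by move=> TT [t e tT]; exists t => //; apply: leq_trans TT. Qed.

Lemma runs_seq P Q s1 T1 s2 T2 s3 :
  runs P s1 T1 s2 -> runs Q s2 T2 s3 -> runs (Seq P Q) s1 (T1 + T2) s3.
Proof.
by move=> [t1 e1 l1] [t2 e2 l2]; exists (t1 + t2)%N; [exact: ExecSeq e1 e2|exact: leq_add].
Qed.

Definition run_block (cs : seq (instr F)) s := foldl (fun s c => step c s) s cs.

Definition prefix (cs : seq (instr F)) P := foldr (fun c => Seq (Instr c)) P cs.

Lemma runs_prefix cs P s T s' :
  runs P (run_block cs s) T s' -> runs (prefix cs P) s (size cs + T) s'.
Proof.
elim: cs s => [|c cs IH] s //= /IH r.
by rewrite -add1n -addnA; apply: runs_seq r; exists 1%N => //; apply: ExecInstr.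
Qed.

Lemma runs_instr c s s' : step c s = s' -> runs (Instr c) s 1 s'.
Proof. by move=> <-; exists 1%N => //; apply: ExecInstr. Qed.

(** The invariant is the whole state [f k] at counter value k. Each round adds one test to its body,
    and the last, failing test gives the outer successor. *)
Lemma runs_countdown z c P (f : nat -> state F) T m :
  (forall k, (k <= m)%N -> reg (f k) z = 0%N /\ reg (f k) c = k) ->
  (forall k, (k < m)%N -> runs P (f k.+1) T (f k)) ->
  runs (While (TLt z c) P) (f m) (m * T.+1).+1 (f 0%N).
Proof.
elim: m => [|m IH] fr fs.
  exists 1%N => //; apply: ExecWhileF => /=.
  by have [-> ->] := fr 0%N (leqnn _).
have [t e tT] := fs m (leqnn _).
have [||t' e' tT'] := IH.
- by move=> k km; apply: fr; apply: leqW.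
- by move=> k km; apply: fs; apply: leqW.
exists (t + t').+1; last by move: tT tT'; rewrite mulSn; lia.
apply: ExecWhileT e e' => /=.
by have [-> ->] := fr m.+1 (leqnn _).
Qed.

(** The default 0 covers all registers beyond the list, and updates of a concrete list reduce by
    computation. *)
Definition regs (l : seq nat) (m : nat -> F) : state F := State (nth 0%N l) m.

Lemma set_reg_regs l m i v : set_reg (regs l m) i v = regs (set_nth 0%N l i v) m.
Proof.
by congr State; apply: functional_extensionality => k; rewrite nth_set_nth.
Qed.

Lemma set_cell_regs l m i a :
  set_cell (regs l m) i a = regs l [eta m with nth 0%N l i |-> a].
Proof. by []. Qed.

Lemma init_regs n x k : init n x = regs (n :: nseq k 0%N) (nth (0 : F) x).
Proof.
congr State; apply: functional_extensionality => -[|i] //=.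
by rewrite nth_nseq if_same.
Qed.

(** Repeated addition; registers 1 and 2 are to hold 0 and 1, and [t] counts down. *)
Definition multiply (d i j t : nat) : prog F :=
  prefix [:: RConst F d 0; RCopy F t j]
    (While (TLt 1 t) (prefix [:: RAdd F d d i] (Instr (RSub F t t 2)))).

Lemma runs_multiply (d i j t : nat) l m :
  uniq [:: 1; 2; d; i; t]%N -> j != d -> nth 0%N l 1 = 0%N -> nth 0%N l 2 = 1%N ->
  runs (multiply d i j t) (regs l m) (3 * nth 0%N l j + 3)
    (regs (set_nth 0%N (set_nth 0%N l d (nth 0%N l i * nth 0%N l j)%N) t 0%N) m).
Proof.
move=> /= /and5P[n1 n2 n3 n4 _] jd l1 l2.
pose f k := regs (set_nth 0%N (set_nth 0%N l d (nth 0%N l i * (nth 0%N l j - k))%N) t k) m.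
move: n1 n2 n3 n4; rewrite !inE !negb_or => /and4P[n12 n1d n1i n1t] /and3P[n2d n2i n2t].
move=> /andP[ndi ndt] nit.
apply: runs_weaken (runs_prefix (T := (nth 0%N l j * 3).+1) _); first by rewrite /=; lia.
rewrite /= !set_reg_regs /= (negbTE jd).
have -> : regs (set_nth 0%N (set_nth 0%N l d 0%N) t (nth 0%N l j)) m = f (nth 0%N l j).
  by rewrite /f subnn muln0.
have -> : regs (set_nth 0%N (set_nth 0%N l d (nth 0%N l i * nth 0%N l j)%N) t 0%N) m = f 0%N.
  by rewrite /f subn0.
apply: (runs_countdown (T := 2)) => [k _|k kj].
  by rewrite /f /= !nth_set_nth /= nth_set_nth /= (negbTE n1d) (negbTE n1t) eqxx.
apply: (runs_prefix (cs := [:: _])); apply: runs_instr.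
congr State; apply: functional_extensionality => a /=.
rewrite !nth_set_nth /= !nth_set_nth /= (eq_sym i d) (eq_sym t d).
rewrite (negbTE ndi) (negbTE ndt) (negbTE nit).
rewrite (negbTE n2t) (negbTE n2d) !eqxx l2 subn1 /=.
case: (a == t) => //; case: (a == d) => //.
by rewrite -mulnSr -subSn // subSS.
Qed.

End Runs.
Arguments prefix : simpl never.

(** * The program that builds B from A *)

Section BuildGadget.

Variable F : fieldType.

(* Registers: 0: n, 1: zero, 2: one, 3, 4: loop counters for i and j, 5: counter
   for the weight, 6, 7, 8: addresses of the entry E_(0, in+j+1), of A(i, j) and
   of the entry E_(in+j+1, 0), 9: S, 10, 11: decrements of registers 6 and 8
   between consecutive j, 12: their common decrement before each new row i, 13: scratch. *)
Definition add_weighted : prog F :=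
  While (TLt 1 5) (prefix [:: RSub F 5 5 2] (Instr (FAdd F 6 6 7))).

Definition write_entry : prog F :=
  prefix [:: RSub F 4 4 2; RSub F 6 6 10; RSub F 8 8 11; RSub F 7 7 2;
             FConst 6 0; RAdd F 5 0 3; RAdd F 5 5 2]
    (Seq add_weighted (prefix [:: FConst 7 0] (Instr (FConst 8 1)))).

Definition write_row : prog F :=
  prefix [:: RSub F 3 3 2; RSub F 6 6 12; RSub F 8 8 12; RCopy F 4 0]
    (While (TLt 1 4) write_entry).

Definition write_gadget : prog F := While (TLt 1 3) write_row.

(** Addresses start at the pair (n, 0), one past the last row, because each round decrements before
    it writes. Register 8 starts from the cube of S, since S = (2n)^2. The second factor of a
    product sets its cost and is at most S. *)
Definition setup (P : prog F) : prog F :=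
  Seq (prefix [:: RConst F 2 1] (multiply F 7 0 0 13))
 (prefix [:: RAdd F 9 7 7; RAdd F 9 9 9]
 (Seq (multiply F 10 9 9 13)
 (Seq (multiply F 12 10 0 13)
 (Seq (multiply F 6 12 0 13)
 (Seq (multiply F 8 10 9 13)
 (Seq (multiply F 4 9 7 13)
 (prefix [:: RAdd F 6 6 6; RAdd F 6 6 7; RAdd F 6 6 2;
             RAdd F 8 8 12; RAdd F 8 8 4; RAdd F 8 8 9;
             RAdd F 11 10 9; RAdd F 10 10 2; RConst F 4 0; RCopy F 3 0] P))))))).

(** [P] expects an initial state; registers 0 and 1 still hold n and 0. *)
Definition cleanup (P : prog F) : prog F :=
  prefix [seq RConst F i 0 | i <- iota 2 12] P.

(** For n = 0 also S = 0 and [sdet] has no (0, 0) entry, so the empty permanent 1 is written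
    directly; register 1 holds 0 and thus points to cell 0. *)
Definition reduction (P : prog F) : prog F :=
  If (TLt 1 0) (setup (Seq write_gadget (cleanup P))) (Instr (FConst 1 1)).

Variables (n : nat) (g : nat -> F).
Hypothesis n_gt0 : (0 < n)%N.
Let S := (4 * n ^ 2)%N.

Definition loop_state (i j k : nat) (m : nat -> F) : state F :=
  regs [:: n; 0; 1; i; j; k; row_cell n i j; i * n + j; col_cell n i j;
        S; (S * S).+1; S * S + S; n * (S * S); 0]%N m.

Lemma row_cell_succ i j : row_cell n i j.+1 = (row_cell n i j + (S * S).+1)%N.
Proof. by rewrite /row_cell /position -/S; lia. Qed.

Lemma col_cell_succ i j : col_cell n i j.+1 = (col_cell n i j + (S * S + S))%N.
Proof. by rewrite /col_cell /position -/S; lia. Qed.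

(** Only n of the 2n blocks in a block row are visited; the other n are skipped. *)
Lemma row_cell_next i : row_cell n i.+1 0 = (row_cell n i n + n * (S * S))%N.
Proof. by rewrite /row_cell /position -/S; lia. Qed.

Lemma col_cell_next i : col_cell n i.+1 0 = (col_cell n i n + n * (S * S))%N.
Proof. by rewrite /col_cell /position -/S; lia. Qed.

Lemma runs_add_weighted i j m k :
  m (row_cell n i j) = 0 ->
  runs add_weighted (loop_state i j k m) (k * 3).+1
    (loop_state i j 0 [eta m with row_cell n i j |-> k%:R * m (i * n + j)%N]).
Proof.
move=> m0; set x := row_cell n i j.
(* The summand A(i, j) must survive the additions into the target cell. *)
have xy : ((i * n + j)%N == x) = false by have := row_cell_gt n_gt0 i j; rewrite -/x; lia.
pose f l := loop_state i j l [eta m with x |-> (k - l)%:R * m (i * n + j)%N].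
have -> : loop_state i j k m = f k.
  rewrite /f; congr State; apply: functional_extensionality => a /=.
  by rewrite subnn mul0r; case: eqP => [->|].
have -> : loop_state i j 0 [eta m with x |-> k%:R * m (i * n + j)%N] = f 0%N.
  by rewrite /f subn0.
apply: (runs_countdown (T := 2)) => // l lk.
apply: (runs_prefix (cs := [:: _])); apply: runs_instr.
rewrite /= set_reg_regs set_cell_regs /cell /= -/x eqxx xy subn1 /=.
congr State; apply: functional_extensionality => a /=; case: eqP => // _.
by rewrite -(@subSS l k) subSn // mulrSr mulrDl mul1r.
Qed.

Lemma runs_write_entry i j : (i < n)%N -> (j < n)%N ->
  runs write_entry (loop_state i j.+1 0 (memory n g (i * n + j).+1)) (6 * n + 16)
    (loop_state i j 0 (memory n g (i * n + j))).
Proof.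
move=> i_lt j_lt.
have xy : ((i * n + j)%N == row_cell n i j) = false by have := row_cell_gt n_gt0 i j; lia.
apply: runs_weaken (runs_prefix (T := ((n + i).+1 * 3).+1 + 2) _).
  by rewrite /=; lia.
rewrite /= !set_reg_regs /= row_cell_succ col_cell_succ !addnK !subn1 /= !(addnS (i * n)) addn1 /=.
apply: runs_seq; first by apply: runs_add_weighted; rewrite /= eqxx.
apply: (runs_prefix (cs := [:: _])); apply: runs_instr.
rewrite /= set_cell_regs; congr State.
rewrite memory_step //= xy memory_read //.
apply: functional_extensionality => a /=.
by case: (a == col_cell n i j); case: (a == _) => //; case: (a == _).
Qed.

Lemma runs_write_row i : (i < n)%N ->
  runs write_row (loop_state i.+1 0 0 (memory n g (i.+1 * n))) (6 * n ^ 2 + 17 * n + 5)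
    (loop_state i 0 0 (memory n g (i * n))).
Proof.
move=> i_lt.
apply: runs_weaken (runs_prefix (T := (n * (6 * n + 16).+1).+1) _).
  by rewrite /=; lia.
rewrite /= !set_reg_regs /= row_cell_next col_cell_next !addnK addn0 mulSn (addnC n) subn1 /=.
pose f j := loop_state i j 0 (memory n g (i * n + j)).
have f0 : loop_state i 0 0 (memory n g (i * n)) = f 0%N by rewrite /f addn0.
rewrite f0; apply: (runs_countdown (f := f) (T := (6 * n + 16)%N)) => // j jn.
by rewrite /f addnS; apply: runs_write_entry.
Qed.

Lemma runs_write_gadget :
  runs write_gadget (loop_state n 0 0 (memory n g (n ^ 2)))
    (n * (6 * n ^ 2 + 17 * n + 5).+1).+1
    (loop_state 0 0 0 (memory n g 0)).
Proof.
rewrite -mulnn.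
pose f i := loop_state i 0 0 (memory n g (i * n)).
apply: (runs_countdown (f := f) (T := (6 * n ^ 2 + 17 * n + 5)%N)) => // i; exact: runs_write_row.
Qed.

Lemma runs_setup P T s m :
  runs P (loop_state n 0 0 m) T s ->
  runs (setup P) (regs (n :: nseq 13 0%N) m) (12 * n + 6 * S + 3 * n ^ 2 + 100 + T) s.
Proof.
(* The code is first run symbolically; the resulting registers are then compared with
   [loop_state n 0 0]. *)
move=> rP; have {}rP st : st = loop_state n 0 0 m -> runs P st T s by move=> ->.
apply: runs_weaken; last first.
  eapply runs_seq.
    by apply: runs_prefix; rewrite /= set_reg_regs /=; apply: runs_multiply.
  eapply runs_prefix; rewrite /= !set_reg_regs /=.
  eapply runs_seq; first exact: runs_multiply.
  rewrite /=.
  eapply runs_seq; first exact: runs_multiply.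
  rewrite /=.
  eapply runs_seq; first exact: runs_multiply.
  rewrite /=.
  eapply runs_seq; first exact: runs_multiply.
  rewrite /=.
  eapply runs_seq; first exact: runs_multiply.
  rewrite /=.
  eapply runs_prefix; rewrite /= !set_reg_regs /=.
  apply: rP; rewrite /loop_state.
  apply: (congr1 (fun l => regs l m)); rewrite /row_cell /col_cell /position -/S.
  by do !congr (_ :: _); rewrite /S; lia.
by rewrite /= /S; lia.
Qed.

Lemma runs_cleanup P T s i j m :
  runs P (regs (n :: nseq 13 0%N) m) T s ->
  runs (cleanup P) (loop_state i j 0 m) (12 + T) s.
Proof.
move=> rP; apply: runs_prefix.
by rewrite /= !set_reg_regs.
Qed.

End BuildGadget.

(** * The complete reduction and its polynomial bound *)

Lemma runs_reduction (F : fieldType) n (A : 'M[F]_n) P T s : (0 < n)%N ->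
  runs P (init n (mxmx_code (gadget n (nth 0 (mx_code A)) (4 * n ^ 2)))) T s ->
  runs (reduction P) (init n (mx_code A)) (200 * (n ^ 2).+1 ^ 2 + T) s.
Proof.
move=> n_gt0; rewrite !(init_regs _ _ 13) -memory_empty // => rP.
set g := nth 0 (mx_code A) in rP *.
have g_full : g = memory n g (n ^ 2).
  rewrite memory_full // => a na; rewrite /g nth_default //.
  by rewrite size_mx_code mulnn.
have [t e tT] := runs_setup n_gt0
  (runs_seq (runs_write_gadget g n_gt0) (runs_cleanup 0 0 rP)).
rewrite -g_full in e; exists t.+1; first exact: ExecIfT.
apply: leq_ltn_trans tT _.
(* Building B takes time cubic in n, which is within the square of the input length plus one. *)
have n3 : (n * n ^ 2 <= (n ^ 2).+1 ^ 2)%N by nia.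
have : (n <= n ^ 2)%N by nia.
by move: n3; rewrite !mulnDr; set a := (n * n ^ 2)%N; set b := (n ^ 2)%N; nia.
Qed.

Theorem theorem6p2 (F : fieldType) (charF0 : [pchar F] =i pred0) :
  exists c : nat, (0 < c)%N /\
    let S := fun n : nat => (c * n ^ 2)%N in
    (poly_time (X := fun n => 'M['M[F]_(S n)]_(2 * n))
               (Y := fun n => 'M[F]_(S n))
               (fun n => @mxmx_code F (S n) (2 * n))
               (fun n => @mx_code F (S n) (S n))
               (fun n => @sdet F (S n) (2 * n)) ->
     poly_time (X := fun n => 'M[F]_n)
               (Y := fun n => F)
               (fun n => @mx_code F n n)
               (fun n => @scalar_code F)
               (fun n => @permanent F n)).
Proof.
(* Unit indices reach n^2, so S must exceed n^2; c = 4 moreover gives S = (2n)^2, used for the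
   addresses. *)
exists 4%N; split=> // S [P [k HP]].
(* With m = n^2 + 1, building B costs at most 200 m^2, and [P] runs on an input of length 64 n^6,
   hence in time k 64^k m^(3k). One number bounds both the factor and the exponent. *)
exists (reduction P), (200 + k * 64 ^ k + 3 * k + 2)%N => n A.
case: (posnP n) => [n0 | n_gt0].
  exists 2%N, (set_cell (init n (mx_code A)) 1 1); split.
  - by apply: ExecIfF; [rewrite /= n0 | apply: ExecInstr].
  - by apply: (@leq_trans (200 + k * 64 ^ k + 3 * k + 2)); [lia | rewrite leq_pmulr ?expn_gt0].
  - rewrite /= /scalar_code /permanent; congr [:: _]; subst n.
    rewrite (big_pred1 1%g) ?big_ord0 // => u /=.
    by apply/esym/eqP/permP => -[].
set m := (n ^ 2).+1.
have [t [s [e tb out]]] := HP n (gadget n (nth 0 (mx_code A)) (S n)).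
have [t' e' tb'] : runs (reduction P) (init n (mx_code A)) (200 * m ^ 2 + t) s.
  by apply: runs_reduction => //; exists t.
exists t', s; split=> //.
  rewrite size_mx_code mulnn -/m; apply: leq_trans tb' _.
  have tm : (t <= k * 64 ^ k * m ^ (3 * k))%N.
    apply: leq_trans tb _.
    rewrite -mulnA leq_mul2l expnM -expnMn.
    case: (posnP k) => //= k_gt0; rewrite leq_exp2r // ?orbT.
    rewrite size_mxmx_code /S /m.
    set b := (n ^ 2)%N.
    have -> : (2 * n * (2 * n * (4 * b * (4 * b))) = 64 * b ^ 3)%N by rewrite /b; lia.
    by rewrite !expnS expn0; nia.
  apply: (@leq_trans ((200 + k * 64 ^ k) * m ^ (3 * k + 2))%N).
    rewrite mulnDl leq_add //; first by rewrite leq_mul2l leq_pexp2l ?leq_addl.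
    by apply: leq_trans tm _; rewrite leq_mul2l leq_pexp2l ?leq_addr ?orbT.
  by rewrite leq_mul // ?leq_pexp2l //; lia.
have S_gt0 : (0 < S n)%N by rewrite muln_gt0 expn_gt0 n_gt0.
rewrite /scalar_code /=; congr [:: _].
(* In row-major order the (0, 0) entry of the output is cell 0, where the permanent is read. *)
pose o := Ordinal S_gt0.
have := congr1 (nth 0 ^~ 0%N) out.
have := nth_mx_code (sdet (gadget n (nth 0 (mx_code A)) (S n))) o o.
rewrite mul0n => ->; rewrite nth_mkseq ?size_mx_code ?(muln_gt0 (S n)) ?S_gt0 // => ->.
rewrite sdet_gadget //; last by rewrite /S; nia.
by congr permanent; apply/matrixP => i j; rewrite mxE nth_mx_code.
Qed.
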